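(* If $X$ is an (infinite) $T_1$-space, then $|X|\le 2^{nu_s(X)\cdot 2^{s(X)}}$.
   Context: For a space $X$ and $A\subseteq X$, the $\theta$-closure of $A$ is $\mathrm{cl}_\theta(A):=\{y\in X:\ \overline{B}\cap A\neq\emptyset$ for every open neighborhood $B$ of $y\}$. The non-Urysohn number of $X$ with respect to singletons is $nu_s(X):=1+\sup\{|\mathrm{cl}_\theta(\{x\})|:x\in X\}$. $s(X)$ denotes the spread of $X$ (supremum of cardinalities of discrete subspaces, plus $\omega$). Throughout, ''space'' means infinite topological space. *)

(* Defs.v *)
From HB Require Import structures.
From mathcomp Require Import all_boot all_order.
From mathcomp Require Import boolp classical_sets functions cardinality topology.
Set Implicit Arguments. Unset Strict Implicit. Unset Printing Implicit Defensive.
Local Open Scope classical_set_scope.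

Definition cl_theta {X : topologicalType} (A : set X) : set X :=
  [set y | forall B : set X, open B -> B y -> closure B `&` A !=set0].

Definition discrete_subspace {X : topologicalType} (D : set X) : Prop :=
  forall x, D x -> exists U : set X, [/\ open U, U x & U `&` D = [set x]].

(* nu_s(X) <= |K|, where nu_s(X) = 1 + sup_x |cl_theta {x}|:
   for each x, 1 + |cl_theta {x}| <= |K|, i.e. cl_theta {x} injects into
   K minus one point. *)
Definition nu_s_le (X : topologicalType) (K : Type) : Prop :=
  exists k0 : K, forall x : X, (cl_theta [set x] #<= [set: K] `\ k0)%card.

(* s(X) <= |L|, where s(X) = sup{|D| : D discrete} + omega *)
Definition spread_le (X : topologicalType) (L : Type) : Prop :=
  infinite_set [set: L] /\
  forall D : set X, discrete_subspace D -> (D #<= [set: L])%card.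

(* Main.v *)
(* Let kappa = nu_s(X) * 2^s(X).

   Every point x is the intersection of at most kappa open sets. Each y outside
   cl_theta {x} has an open neighbourhood B y whose closure misses x, and by
   Shapirovskii's lemma some discrete set D satisfies
   X \ cl_theta {x} <= closure D U U_{d in D} B d. The points of the second part
   are separated from x by the sets X \ closure (B d), those of the first by the
   sets X \ closure A with A <= D and x notin closure A, and the points of
   cl_theta {x} one at a time, by T1.

   Then |X| <= 2^kappa follows as in the Hajnal-Juhasz theorem, with the
   Erdos-Rado tree argument unfolded: well-order X, colour each pair z < y by
   indices of open sets separating z and y in both directions, and let P x be the
   set of tree predecessors of x. The fibres of the colouring on P x are discrete,
   so |P x| <= kappa, and x is determined by P x with its order and colours. *)
Require Import Defs.
From mathcomp Require Import all_boot all_order.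
From mathcomp Require Import boolp classical_sets functions cardinality topology.
From mathcomp Require Import wochoice.
Set Implicit Arguments. Unset Strict Implicit. Unset Printing Implicit Defensive.
Local Open Scope classical_set_scope.
Local Open Scope card_scope.

(** * Cardinal comparability and squares of infinite sets *)

Lemma card_le_ex_inj T U (A : set T) (B : set U) (u0 : U) :
  A #<= B -> exists2 f : T -> U, set_fun A B f & set_inj A f.
Proof.
elim/Ppointed: U => U in B u0 *; first by case: (no u0).
by move=> /pcard_leP; rewrite injfunPex.
Qed.

Lemma card_le_of_inj T U (A : set T) (B : set U) (f : T -> U) :
  set_fun A B f -> set_inj A f -> A #<= B.
Proof.
move=> fAB finj; have [g] : $|{injfun A >-> B}| by apply/injfunPex; exists f.
exact: inj_card_le g.
Qed.

Lemma card_le_of_rel T U (A : set T) (B : set U) (R : T -> U -> Prop) :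
  (forall a, A a -> exists2 b, B b & R a b) ->
  (forall a a' b, A a -> A a' -> R a b -> R a' b -> a = a') -> A #<= B.
Proof.
move=> RAB Rinj; have [[u0]|noU] := pselect (inhabited U); last first.
  suff -> : A = set0 by exact: card_ge0.
  by apply/seteqP; split=> // a /RAB[b _ _]; case: noU.
have /choice[f fP] : forall a, exists b, A a -> B b /\ R a b.
  move=> a; have [Aa|nAa] := pselect (A a); last by exists u0.
  by have [b] := RAB a Aa; exists b.
apply: (@card_le_of_inj _ _ _ _ f) => [a /fP[]//|a a' /set_mem Aa /set_mem Aa' e].
by apply: (Rinj a a' (f a)) => //; [|rewrite e]; apply: (fP _ _).2.
Qed.

(** Zorn's lemma on graphs of partial injections: a maximal graph exhausts [A] or [B], since
    otherwise a fresh pair could be added. *)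
Lemma card_le_total T U (A : set T) (B : set U) : A #<= B \/ B #<= A.
Proof.
pose P (G : set (T * U)) := G `<=` A `*` B /\
  (forall p q, G p -> G q -> p.1 = q.1 <-> p.2 = q.2).
have [F FP Ftot|G [[GAB Ginj] Gmax]] := @Zorn_bigcup (T * U)%type P.
  split=> [p [G /FP[GAB _] /GAB]//|p q [G FG Gp] [H FH Hq]].
  have [GH|HG] := Ftot _ _ FG FH.
    by apply: (FP _ FH).2 => //; apply: GH.
  by apply: (FP _ FG).2 => //; apply: HG.
have [domG|/existsNP[a /not_implyP[Aa aG]]] :=
  pselect (forall a, A a -> exists b, G (a, b)).
  left; apply: (@card_le_of_rel _ _ _ _ (fun a b => G (a, b))).
    by move=> a /domG[b Gab]; exists b => //; have [] := GAB _ Gab.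
  by move=> a a' b _ _ Gab Ga'b; apply/(Ginj _ _ Gab Ga'b).
have [ranG|/existsNP[b /not_implyP[Bb bG]]] :=
  pselect (forall b, B b -> exists a, G (a, b)).
  right; apply: (@card_le_of_rel _ _ _ _ (fun b a => G (a, b))).
    by move=> b /ranG[x Gxb]; exists x => //; have [] := GAB _ Gxb.
  by move=> y y' x _ _ Gab Gab'; apply/(Ginj _ _ Gab Gab').
exfalso; apply: (Gmax (G `|` [set (a, b)])).
  split=> [|/(_ (a, b) (or_intror erefl)) Gab]; first exact: subsetUl.
  by apply: aG; exists b.
split=> [p [/GAB//|->//]|[s t] [s' t'] /= [Gp [Gq|]|]]; first exact: (Ginj _ _ Gp Gq).
- by move=> [-> ->]; split=> e; subst; exfalso; [apply: aG|apply: bG]; eexists; apply: Gp.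
- move=> [-> ->] [Gq|[-> ->]//].
  by split=> e; subst; exfalso; [apply: aG|apply: bG]; eexists; apply: Gq.
Qed.

Lemma card_leX T U T' U' (A : set T) (B : set U) (A' : set T') (B' : set U') :
  A #<= A' -> B #<= B' -> A `*` B #<= A' `*` B'.
Proof.
have [-> _ _|/set0P[a Aa]] := eqVneq A set0; first by rewrite set0X; apply: card_ge0.
have [-> _ _|/set0P[b Bb]] := eqVneq B set0; first by rewrite setX0; apply: card_ge0.
move=> AA' BB'.
have a' : T'.
  have : A' !=set0.
    apply/set0P/eqP => A'0; move: AA'; rewrite A'0 card_le0 => /eqP A0.
    by rewrite A0 in Aa.
  by case/cid.
have b' : U'.
  have : B' !=set0.
    apply/set0P/eqP => A'0; move: BB'; rewrite A'0 card_le0 => /eqP A0.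
    by rewrite A0 in Bb.
  by case/cid.
have [f fA finj] := card_le_ex_inj a' AA'; have [g gB ginj] := card_le_ex_inj b' BB'.
apply: (@card_le_of_inj _ _ _ _ (fun p => (f p.1, g p.2))).
  by move=> [x y] [/= /fA fx /gB gy].
move=> [x y] [x' y'] /set_mem[/= Ax By] /set_mem[/= Ax' By'] [fx gy].
by congr pair; [apply: finj|apply: ginj]; rewrite ?inE.
Qed.

(** The square of [D] holds two disjoint copies of [D], tagged by [d] and [e]: one receives [D], the
    other the rest of [E]. *)
Lemma card_le_setU_sqr T (D E : set T) (d e : T) :
  D d -> D e -> d <> e -> D `*` D #<= D -> E #<= D ->
  (D `|` E) `*` (D `|` E) #<= D.
Proof.
move=> Dd De de DD ED; have [f fD finj] := card_le_ex_inj d ED.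
suff UD : D `|` E #<= D by apply: card_le_trans DD; apply: card_leX.
apply: card_le_trans DD.
apply: (@card_le_of_inj _ _ _ _ (fun x => if x \in D then (d, x) else (e, f x))).
  move=> x DEx /=; case: ifPn => [/set_mem //|].
  by rewrite notin_setE => nDx; case: DEx => // /fD.
move=> x y /set_mem DEx /set_mem DEy.
case: ifPn => [_|]; case: ifPn => [_|]; rewrite ?notin_setE.
- by case.
- by move=> _ [/de].
- by move=> _ [/esym /de].
move=> nDy nDx [fxy]; case: DEx => // Ex; case: DEy => // Ey.
by apply: finj; rewrite ?inE.
Qed.

(** Take [G] maximal by Zorn. If the complement of [D] embeds in [D], then the square of [T] does
    too; if it contains a copy of [D], then [G] could be extended. *)
Lemma infinite_card_sqr T : infinite_set [set: T] -> [set: T * T] #<= [set: T].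
Proof.
move=> Tinf; pose fld (G : set (T * T * T)) := [set a | exists c, G (a, a, c)].
(* Graphs of injections of D x D into D, for subsets D = [fld G] of T. *)
pose P (G : set (T * T * T)) := [/\
  forall a b, fld G a -> fld G b -> exists c, G (a, b, c),
  forall a b c, G (a, b, c) -> [/\ fld G a, fld G b & fld G c] &
  forall p q, G p -> G q -> p.1 = q.1 <-> p.2 = q.2].
have [F FP Ftot|G [[Gtot Gfld Ginj] Gmax]] := @Zorn_bigcup (T * T * T)%type P.
  have fldS G H : G `<=` H -> fld G `<=` fld H by move=> GH a [c /GH]; exists c.
  split=> [a b [c [G FG Gc]] [d [H FH Hd]]|a b c [G FG Gabc]|p q [G FG Gp] [H FH Hq]].
  - have [GH|HG] := Ftot _ _ FG FH.
      have [||e He] := (let: And3 t _ _ := FP _ FH in t) a b.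
      + by exists c; apply: GH.
      + by exists d.
      by exists e; exists H.
    have [||e He] := (let: And3 t _ _ := FP _ FG in t) a b.
    + by exists c.
    + by exists d; apply: HG.
    by exists e; exists G.
  - have [Ga Gb Gc] := (let: And3 _ t _ := FP _ FG in t) a b c Gabc.
    by split; apply: fldS; try eassumption; move=> x Gx; exists G.
  - have [GH|HG] := Ftot _ _ FG FH.
      by have [_ _] := FP _ FH; apply=> //; apply: GH.
    by have [_ _] := FP _ FG; apply=> //; apply: HG.
pose D := fld G.
have DD : D `*` D #<= D.
  apply: (@card_le_of_rel _ _ _ _ (fun p c => G (p, c))).
    by move=> [a b] [/= Da Db]; have [c Gc] := Gtot a b Da Db;
      exists c => //; have [] := Gfld _ _ _ Gc.
  by move=> p q c _ _ Gp Gq; apply/(Ginj _ _ Gp Gq).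
have noext (E : set T) : E !=set0 -> E `<=` ~` D ->
    ~ ((D `|` E) `*` (D `|` E) #<= E).
  move=> [e0 Ee0] EnD /(card_le_ex_inj e0)[f fE finj].
  (* The new pairs take values in [E], disjoint from [D], so they never collide with values of
     [G]. *)
  pose G' := G `|` [set q | [/\ (D `|` E) q.1.1, (D `|` E) q.1.2,
    ~ (D q.1.1 /\ D q.1.2) & q.2 = f q.1]].
  have fldG' : fld G' = D `|` E.
    apply/seteqP; split=> [a [c [Gc|[] //]]|a [[c Gc]|Ea]].
    - by left; exists c.
    - by exists c; left.
    - by exists (f (a, a)); right; split=> //=; [right|right|case => /(EnD _ Ea)].
  apply: (Gmax G'); [split=> [|G'G]; first exact: subsetUl|split=> [a b|a b c|]].
  - apply: (EnD _ Ee0); rewrite /D; have : fld G' e0 by rewrite fldG'; right.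
    by move=> [c /G'G]; exists c.
  - rewrite fldG' => DEa DEb; have [[Da Db]|nD] := pselect (D a /\ D b).
      by have [c Gc] := Gtot _ _ Da Db; exists c; left.
    by exists (f (a, b)); right.
  - rewrite fldG' => -[/Gfld[? ? ?]|[/= DEa DEb _ ->]]; first by split; left.
    by split=> //; right; apply: fE.
  - have GE p q : G p -> (D `|` E) q.1.1 -> (D `|` E) q.1.2 ->
        ~ (D q.1.1 /\ D q.1.2) -> q.2 = f q.1 -> p.1 <> q.1 /\ p.2 <> q.2.
      case: p => [[a b] c] /Gfld[Da Db Dc] DE1 DE2 nD e; split=> /= [e1|e2].
        by apply: nD; rewrite -e1.
      by apply: (EnD c) => //; rewrite e2 e; apply: fE.
    move=> p q [Gp|[p1 p2 pD pf]] [Gq|[q1 q2 qD qf]]; first exact: Ginj.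
    + by have [n1 n2] := GE p q Gp q1 q2 qD qf; split=> [/n1|/n2].
    + by have [n1 n2] := GE q p Gq p1 p2 pD pf; split=> [/esym/n1|/esym/n2].
    + rewrite pf qf; split=> [->//|/finj]; rewrite !inE; apply; by [].
have [[d [e [Dd De de]]]|D1] := pselect (exists d e, [/\ D d, D e & d <> e]).
  have [DnD|nDD] := card_le_total D (~` D).
    have [f fnD finj] := card_le_ex_inj d DnD.
    exfalso; apply: (noext (f @` D)).
    - by exists (f d); exists d.
    - by move=> _ [x Dx <-]; apply: fnD.
    have /card_eqPle[fD Df] := inj_card_eq finj.
    exact: card_le_trans (card_le_setU_sqr Dd De de DD fD) Df.
  have := card_le_setU_sqr Dd De de DD nDD.
  rewrite setUv setXTT => /card_le_trans; apply; exact: card_leT.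
(* Here [D] has at most one point, so a countably infinite subset of the complement serves as the
   extension. *)
have Dfin : finite_set D.
  have [->|/set0P[d Dd]] := eqVneq D set0; first exact: finite_set0.
  apply: (sub_finite_set _ (finite_set1 d)) => x Dx /=.
  by apply: contrapT => xd; apply: D1; exists x, d.
have [|u0 _] := @infinite_setN0 T setT => //.
have /infiniteP/(card_le_ex_inj u0)[f fnD finj] : infinite_set (~` D).
  by rewrite -setTD; apply: infinite_setD.
exfalso; apply: (noext (range f)).
- by exists (f 0%N); exists 0%N.
- by move=> _ [n _ <-]; apply: fnD.
have /card_eqPle[fD Df] := inj_card_eq finj.
have cnt : countable (D `|` range f).
  rewrite -bigcup2E; apply: bigcup_countable => // -[|[|i]] _ //=.
  exact: finite_set_countable.
exact: card_le_trans (countableX cnt cnt) Df.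
Qed.

(** * Well-orders and recursion along them *)

(** Antisymmetry and transitivity of [R] come from least elements of sets of two and three
    points. *)
Lemma strict_well_order (T : eqType) : exists lt : T -> T -> Prop,
  [/\ well_founded lt, (forall x y z, lt x y -> lt y z -> lt x z) &
      forall x y, x <> y -> lt x y \/ lt y x].
Proof.
have [R Rwo] := well_ordering_principle T.
have Rmin (A : pred T) x : A x -> exists2 z, A z & forall y, A y -> R z y.
  move=> Ax; have [|z [[Az zmin] _]] := Rwo A; first by exists x.
  by exists z => // y Ay; apply: zmin.
have Ranti x y : R x y -> R y x -> x = y.
  move=> Rxy Ryx; have Rrefl z : R z z.
    by have [w /eqP -> /(_ _ (eqxx z))] := Rmin (pred1 z) z (eqxx z).
  have [|z [_ zuniq]] := Rwo (pred2 x y); first by exists x; rewrite inE eqxx.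
  rewrite -(zuniq x) 1?(zuniq y) //; split; rewrite ?inE ?eqxx ?orbT //;
    by move=> w; rewrite !inE => /orP[] /eqP ->.
exists (fun x y => R x y /\ x <> y); split.
- move=> x; apply: contrapT => nx.
  pose A := [pred z | `[< ~ Acc (fun x y => R x y /\ x <> y) z >]].
  have [|z /asboolP zA zmin] := Rmin A x; first exact/asboolP.
  apply: zA; constructor => y [Ryz yz]; apply: contrapT => nAy.
  by apply: yz; apply: Ranti => //; apply: zmin; apply/asboolP.
- move=> x y z [Rxy xy] [Ryz yz].
  have [|w] := Rmin (pred3 x y z) x; first by rewrite /= eqxx.
  move=> /or3P[] /eqP -> wmin.
  + split; first by apply: wmin; rewrite /= eqxx !orbT.
    by move=> xz; subst z; apply: xy; apply: Ranti.
  + by case: xy; apply: Ranti => //; apply: wmin; rewrite /= eqxx.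
  + by case: yz; apply: Ranti => //; apply: wmin; rewrite /= eqxx !orbT.
- move=> x y xy; have [|w] := Rmin (pred2 x y) x; first by rewrite /= eqxx.
  move=> /orP[] /eqP -> wmin; [left|right]; split=> //.
  + by apply: wmin; rewrite /= eqxx orbT.
  + by apply: wmin; rewrite /= eqxx.
  + exact/nesym.
Qed.

(** Serves to build both Shapirovskii's discrete set and the sets of tree predecessors. *)
Lemma wf_set_rec T (lt : T -> T -> Prop) (F : T -> set T -> Prop) :
  well_founded lt ->
  exists D : set T, forall y, D y <-> F y (D `&` [set z | lt z y]).
Proof.
move=> wf; pose step y (rec : forall z, lt z y -> Prop) :=
  F y [set z | exists zy : lt z y, rec z zy].
exists (Fix wf (fun=> Prop) step) => y.
rewrite Fix_eq; last first.
  move=> x f g fg; rewrite /step; congr (F x _).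
  by apply/seteqP; split=> z [zx]; exists zx; rewrite ?fg // -fg.
suff -> : Fix wf (fun=> Prop) step `&` [set z | lt z y] =
  [set z | exists _ : lt z y, Fix wf (fun=> Prop) step z] by [].
by apply/seteqP; split=> z [].
Qed.

(** * Discrete sets and separation of points *)

(* Shapirovskii's lemma. *)
Lemma discrete_closure_cover (X : topologicalType) (Y : set X) (B : X -> set X) :
  (forall y, Y y -> open (B y) /\ B y y) ->
  exists D : set X, [/\ D `<=` Y, discrete_subspace D &
    Y `<=` closure D `|` \bigcup_(d in D) B d].
Proof.
move=> BY; have [lt [wf _ lt_total]] := strict_well_order X.
(* Greedy choice: a point of [Y] is taken when the earlier chosen points do not yet cover it. *)
have [D DE] := wf_set_rec (fun y S =>
  Y y /\ ~ (closure S `|` \bigcup_(d in S) B d) y) wf.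
have DY : D `<=` Y by move=> y /DE[].
exists D; split=> //.
  move=> x Dx; have [Bo Bx] := BY _ (DY _ Dx).
  have [_ /not_orP[nclx nBx]] := (DE x).1 Dx.
  (* [B x] contains no later chosen point, and the second factor removes the earlier ones. *)
  exists (B x `&` ~` closure (D `&` [set z | lt z x])); split=> //.
    by apply: openI => //; apply: closed_openC; apply: closed_closure.
  apply/seteqP; split=> [y [[Bxy nclxy] Dy]|_ ->]//.
  apply: contrapT => yx; have [yltx|xlty] := lt_total _ _ yx.
    by apply: nclxy; apply: subset_closure.
  have [_ /not_orP[_]] := (DE y).1 Dy; apply.
  by exists x.
move=> y Yy; apply: contrapT => nDy.
have /not_orP[nclD nB] := nDy; apply: nclD; apply: subset_closure.
apply/DE; split=> //; apply: contra_not nDy.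
have SD : D `&` [set z | lt z y] `<=` D by move=> z [].
by case=> [/(closureS SD)|[d [Dd _] Bd]]; [left|right; exists d].
Qed.

Lemma open_family_at_point (X : topologicalType) (K L : Type) (x : X) :
  accessible_space X -> K -> (cl_theta [set x] #<= [set: K]) ->
  spread_le X L ->
  exists V : K * set L -> set X, (forall i, open (V i) /\ V i x) /\
    forall y, y <> x -> exists i, ~ V i y.
Proof.
move=> T1 k0 /(card_le_ex_inj k0)[h _ hinj] [Linf Ldiscr].
have [l0 _] := infinite_setN0 Linf.
have /choice[B BP] : forall y, exists B : set X, ~ cl_theta [set x] y ->
    [/\ open B, B y & ~ closure B x].
  move=> y; have [cly|] := pselect (cl_theta [set x] y); first by exists set0.
  move=> /existsNP[B /not_implyP[Bo /not_implyP[By nB]]]; exists B => _; split=> //.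
  by move=> clx; apply: nB; exists x.
have [|D [DY Ddiscr Dcover]] := @discrete_closure_cover X (~` cl_theta [set x]) B.
  by move=> y /BP[].
have [g _ ginj] := card_le_ex_inj l0 (Ldiscr D Ddiscr).
(* By injectivity of [h], each [k] codes at most one point to be excluded. *)
have /choice[O OP] : forall k, exists O : set X, [/\ open O, O x &
    forall z, cl_theta [set x] z -> h z = k -> z <> x -> ~ O z].
  move=> k; have [[z [clz hz zx]]|nz] :=
    pselect (exists z, [/\ cl_theta [set x] z, h z = k & z <> x]).
    have [|O [Oo Ox Oz]] := T1 x z; first exact/eqP/nesym.
    exists O; split=> //; first exact/set_mem.
    move=> z' clz' hz' z'x; have -> : z' = z by apply: hinj; rewrite ?inE // hz'.
    exact/set_mem.
  exists setT; split=> //; first exact: openT.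
  by move=> z clz hz zx; case: nz; exists z.
(* The default [setT] keeps [W A] an open neighbourhood of [x] for every [A]. *)
pose W A := if `[< closure A x >] then setT else ~` closure A.
have Wopen A : open (W A).
  rewrite /W; case: ifP => _; first exact: openT.
  by apply: closed_openC; apply: closed_closure.
have Wx A : W A x by rewrite /W; case: ifP => // /asboolP.
have notW A y : ~ closure A x -> closure A y -> ~ W A y.
  by rewrite /W => nx cly; case: ifP => [/asboolP//|_]; apply.
(* The subset [i.2] of [L] is read in two ways through [g]: as a subset of [D], and, if a singleton,
   as one point of [D]. *)
exists (fun i => O i.1 `&` (W (D `&` [set d | i.2 (g d)]) `&`
  W (\bigcup_(d in D `&` [set d | i.2 = [set g d]]) B d))); split=> [[k S]|y yx].
  have [Oo Ox _] := OP k; split=> //.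
  by apply: openI => //; apply: openI; apply: Wopen.
have [cly|ncly] := pselect (cl_theta [set x] y).
  by exists (h y, set0) => -[/= Oy _]; have [_ _ /(_ y cly erefl yx)] := OP (h y).
have [By1 By2 nclB] := BP _ ncly.
have [clD|[d Dd Bd]] := Dcover _ ncly.
  (* Cutting [D] down to [B y] keeps [y] in the closure but puts [x] outside it. *)
  exists (h y, g @` (D `&` B y)) => -[/= _ [+ _]].
  have -> : D `&` [set d | (g @` (D `&` B y)) (g d)] = D `&` B y.
    apply/seteqP; split=> [d [Dd [e [De Be] /ginj ed]]|d [Dd Bd]].
      by rewrite -ed ?inE.
    by split=> //; exists d.
  apply: notW; first by apply: contra_not nclB; apply: closureS => ? [].
  move=> U Uy; have [|d [Dd [Ud Bd]]] := clD (U `&` B y).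
    by apply: filterI => //; apply: open_nbhs_nbhs.
  by exists d.
have [_ _ nclBd] := BP _ (DY _ Dd).
exists (h y, [set g d]) => -[/= _ [_]].
have -> : \bigcup_(e in D `&` [set e | [set g d] = [set g e]]) B e = B d.
  apply/seteqP; split=> [z [e [De /= gde] Be]|z Bz]; last by exists d.
  have <- // : e = d.
  apply: ginj; rewrite ?inE //.
  have : [set g d] (g d) by []; by rewrite gde.
by apply: notW => //; apply: subset_closure.
Qed.

(** * The Erdos-Rado tree and its coding *)

Section EndHomogeneous.
Variables (T C : Type) (lt : T -> T -> Prop).
Hypotheses (wf : well_founded lt) (lt_trans : forall x y z, lt x y -> lt y z -> lt x z)
  (lt_total : forall x y, x <> y -> lt x y \/ lt y x).
Variables (c : T -> T -> C) (P : T -> set T).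
Hypothesis PE : forall x y, P x y <->
  lt y x /\ forall z, P x z -> lt z y -> c z y = c z x.

Lemma lt_irr x : ~ lt x x.
Proof. by elim/(well_founded_ind wf): x => x IH xx; apply: (IH x). Qed.

(* [P x] is the set of predecessors of [x] in the Erdos-Rado tree of [c]. *)
Lemma end_homogeneous_initial x a z : P x a -> P a z <-> P x z /\ lt z a.
Proof.
move=> Pxa; have [ax cax] := (PE x a).1 Pxa.
(* Below [a], predecessors of [x] give [a] and [x] the same colour, so the conditions on [z]
   agree. *)
elim/(well_founded_ind wf): z => z IH; split.
  move=> /PE[za caz]; split=> //; apply/PE; split; first exact: lt_trans ax.
  move=> w Pxw wz; have wa := lt_trans wz za.
  by rewrite caz // ?cax //; apply/IH.
move=> [/PE[zx czx] za]; apply/PE; split=> // w Paw wz.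
by have [Pxw wa] := (IH _ wz).1 Paw; rewrite czx // cax.
Qed.

(** If [u] preceded [v], it would itself qualify as a tree predecessor of [v], hence lie in
    [P u]. *)
Lemma end_homogeneous_inj a b : P a = P b -> (forall z, P a z -> c z a = c z b) -> a = b.
Proof.
have key u v : P u = P v -> (forall z, P u z -> c z u = c z v) -> ~ lt u v.
  move=> Puv cuv ltuv; apply: (@lt_irr u).
  suff /PE[] : P u u by [].
  by rewrite Puv; apply/PE; split=> // z Pvz _; apply: cuv; rewrite Puv.
move=> Pab cab; apply: contrapT => /lt_total[|]; first exact: key.
by apply: key => // z Pbz; rewrite cab // Pab.
Qed.

Variables (I : Type) (p : I * I -> I) (h : T -> T -> I).
Hypotheses (p_inj : injective p) (h_inj : forall x, set_inj (P x) (h x))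
  (h_c : forall x y a b, h x a = h y b -> c a x = c b y).

(* [h x] also records the colours (by [h_c]), so the order on [P x] is all that
   remains to be coded. *)
Definition end_homogeneous_code x : set I :=
  [set i | exists a b, [/\ P x a, P x b, ~ lt b a & i = p (h x a, h x b)]].

(** Equal codes match [P x] with [P y] preserving order and colours. By induction matched points
    coincide, each being fixed by its predecessors and their colours; then so are [x] and [y]. *)
Lemma end_homogeneous_code_inj : injective end_homogeneous_code.
Proof.
have ex x y a : end_homogeneous_code x = end_homogeneous_code y -> P x a ->
    exists2 b, P y b & h x a = h y b.
  move=> xy Pa; have : end_homogeneous_code x (p (h x a, h x a)).
    by exists a, a; split=> //; apply: lt_irr.
  by rewrite xy => -[b [b' [Pb _ _ /p_inj[-> _]]]]; exists b.
have mono x y a a' b b' : end_homogeneous_code x = end_homogeneous_code y ->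
    P x a -> P x b -> P y a' -> P y b' ->
    h x a = h y a' -> h x b = h y b' -> lt a b -> lt a' b'.
  move=> xy Pa Pb Pa' Pb' ha hb ab.
  have : end_homogeneous_code x (p (h x a, h x b)).
    by exists a, b; split=> // ba; apply: (@lt_irr a); apply: lt_trans ba.
  rewrite xy => -[u [v [Pu Pv nvu /p_inj[]]]]; rewrite ha hb => hu hv.
  have {}nvu : ~ lt b' a'.
    have -> : a' = u by apply: (@h_inj y); rewrite ?inE.
    by have -> : b' = v by apply: (@h_inj y); rewrite ?inE.
  have [//|//] : lt a' b' \/ lt b' a'.
  apply: lt_total => e; apply: (@lt_irr a).
  rewrite {2}(_ : a = b) //; apply: (@h_inj x); rewrite ?inE //.
  by rewrite ha hb e.
have same x y a a' : end_homogeneous_code x = end_homogeneous_code y ->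
    P x a -> P y a' -> h x a = h y a' -> a = a'.
  move=> xy; elim/(well_founded_ind wf): a a' => a IH a' Pa Pa' ha.
  have below z : P a z -> P a' z /\ c z a = c z a'.
    move=> /(end_homogeneous_initial _ Pa)[Pxz za].
    have [z' Pyz' hz] := ex _ _ _ xy Pxz.
    have zz' := IH _ za _ Pxz Pyz' hz; subst z'.
    have za' : lt z a' by apply: (mono x y z z a a').
    split; first exact/(end_homogeneous_initial _ Pa').
    rewrite (((PE _ _).1 Pa).2 _ Pxz za) (((PE _ _).1 Pa').2 _ Pyz' za').
    exact: h_c.
  apply: end_homogeneous_inj => [|z /below[]//].
  apply/seteqP; split=> [z /below[]//|z].
  move=> /(end_homogeneous_initial _ Pa')[Pyz za'].
  have [z' Pxz' hz] := ex _ _ _ (esym xy) Pyz.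
  have z'a : lt z' a by apply: (mono y x z z' a' a).
  have zz' := IH _ z'a _ Pxz' Pyz (esym hz); subst z'.
  exact/(end_homogeneous_initial _ Pa).
move=> x y xy.
have sub u v z : end_homogeneous_code u = end_homogeneous_code v ->
    P u z -> P v z /\ c z u = c z v.
  move=> uv Puz; have [z' Pvz' hz] := ex _ _ _ uv Puz.
  by have zz' := same _ _ _ _ uv Puz Pvz' hz; subst z'; split=> //; exact: h_c.
apply: end_homogeneous_inj => [|z /(sub _ _ _ xy)[]//].
by apply/seteqP; split=> z; [move=> /(sub _ _ _ xy)[]|move=> /(sub _ _ _ (esym xy))[]].
Qed.
End EndHomogeneous.

(** * The Hajnal-Juhasz argument and the bound *)

Lemma card_le_powerset_pseudocharacter (X : topologicalType) (I : Type)
    (V : X -> I -> set X) :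
  infinite_set [set: I] ->
  (forall x i, open (V x i) /\ V x i x) ->
  (forall x y, y <> x -> exists i, ~ V x i y) ->
  (forall D : set X, discrete_subspace D -> D #<= [set: I]) ->
  [set: X] #<= [set: set I].
Proof.
move=> Iinf Vopen Vsep spread.
have [i0 _] := infinite_setN0 Iinf.
have [p _ p_inj] := card_le_ex_inj i0 (infinite_card_sqr Iinf).
have {}p_inj : injective p by move=> u v; apply: p_inj; rewrite inE.
have [lt [wf lt_trans lt_total]] := strict_well_order X.
have /choice[c0 c0P] : forall zy : X * X, exists i : I, zy.2 <> zy.1 -> ~ V zy.1 i zy.2.
  move=> [z y]; have [e|/Vsep[i Vi]] := pselect (y = z); first by exists i0.
  by exists i.
pose c z y := p (c0 (z, y), c0 (y, z)).
have cP z y z' y' : c z y = c z' y' -> z <> y ->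
    ~ V z (c0 (z', y')) y /\ ~ V y (c0 (y', z')) z.
  by move=> /p_inj[<- <-] zy; split; apply: (c0P (_, _)) => //; apply/nesym.
have /choice[P PE] : forall x, exists P : set X, forall y, P y <->
    lt y x /\ forall z, P z -> lt z y -> c z y = c z x.
  move=> x; have [D DE] := wf_set_rec
    (fun y S => lt y x /\ forall z, S z -> c z y = c z x) wf.
  exists D => y; rewrite DE; split=> -[yx H]; split=> //.
    by move=> z Dz zy; apply: H.
  by move=> z [Dz zy]; apply: H.
have fibre x i : discrete_subspace (P x `&` [set a | c a x = i]).
  move=> a [Pa ca].
  (* For [b] in the fibre, the colour of the pair [a], [b] is that of [a], [x]: the first set omits
     [b] if [b] comes after [a], the second if before. *)
  exists (V a (c0 (a, x)) `&` V a (c0 (x, a))).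
  have [[Vo Va] [Vo' Va']] := (Vopen a (c0 (a, x)), Vopen a (c0 (x, a))).
  split=> //; first exact: openI.
  apply/seteqP; split=> [b [[Vb Vb'] [Pb cb]]|_ ->//].
  apply: contrapT => /= ba.
  have [ltba|ltab] := lt_total _ _ ba.
    have := ((PE x a).1 Pa).2 _ Pb ltba; rewrite cb -ca => e.
    by have [_] := cP _ _ _ _ e ba.
  have e := ((PE x b).1 Pb).2 _ Pa ltab.
  by have [+ _] := cP _ _ _ _ e (nesym ba).
have /choice[g gP] : forall xi : X * I, exists g : X -> I,
    set_inj (P xi.1 `&` [set a | c a xi.1 = xi.2]) g.
  by move=> [x i]; have [g _ ginj] := card_le_ex_inj i0 (spread _ (fibre x i)); exists g.
(* The colour selects a fibre, and [g] tells its points apart within [I]. *)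
pose h x a := p (c a x, g (x, c a x) a).
have h_inj x : set_inj (P x) (h x).
  move=> a b /set_mem Pa /set_mem Pb /p_inj[cab]; rewrite cab => gab.
  by apply: (gP (x, c b x)); rewrite ?inE.
have h_c x y a b : h x a = h y b -> c a x = c b y by move=> /p_inj[].
apply: (@card_le_of_inj _ _ _ _ (end_homogeneous_code lt P p h)) => // x y _ _.
exact: (end_homogeneous_code_inj wf lt_trans lt_total PE p_inj h_inj h_c).
Qed.

(* |X| <= 2^(nu_s(X) * 2^(s(X))), stated for all cardinals |K| >= nu_s(X), |L| >= s(X)
   (equivalently, for |K| = nu_s(X), |L| = s(X), by monotonicity):
   X injects into the power set of K x P(L). *)
Theorem theorem3p12 (X : topologicalType) :
  accessible_space X -> infinite_set [set: X] ->
  forall (K L : Type), nu_s_le X K -> spread_le X L ->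
  ([set: X] #<= [set: set (K * set L)])%card.
Proof.
move=> T1 _ K L [k0 nuK] sL; have [Linf Ldiscr] := sL.
have /choice[V VP] := fun x => open_family_at_point T1 k0
  (card_le_trans (nuK x) (card_leT _)) sL.
have Lle : [set: L] #<= [set: K * set L].
  (* Singletons embed [L] in the index set, which is thus infinite and bounds all discrete sets. *)
  apply: (@card_le_of_inj _ _ _ _ (fun l => (k0, [set l]))) => // l l' _ _ [e].
  by have : [set l] l by []; rewrite e.
apply: (@card_le_powerset_pseudocharacter X _ V).
- by apply/infiniteP; apply: card_le_trans Lle; apply/infiniteP.
- by move=> x i; apply: (VP x).1.
- by move=> x; apply: (VP x).2.
- by move=> D /Ldiscr DL; apply: card_le_trans Lle.
Qed.
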